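(* Let $1\le q<\infty$, $n\in\mathbb{N}$, and let the parametric family $\{p_\vartheta\}_{\vartheta\in\Theta}$, the complete probability space $(\Omega,\mathcal{F},\mathbb{P})$, the sample $X_1,\dots,X_n$ and the function $\eta_n$ be as described in the context. Assume that the map $\Theta\ni\vartheta\mapsto\frac{p_\vartheta'(x)}{p_\vartheta(x)}$ is continuous for every $x>0$ and that $\Theta$ is a non-empty Borel subset of $\mathbb{R}^d$. Let $\varepsilon_n:\Omega\to(0,\infty)$ be a positive random variable. Then there exists an $(\mathcal{F},\mathcal{B}(\Theta))$-measurable map $\widehat{\vartheta}_{n,q}:\Omega\to\Theta$ such that $$\big\|\eta_n\big(\omega,\cdot,\widehat{\vartheta}_{n,q}(\omega)\big)\big\|_{L^q}\le\inf_{\vartheta\in\Theta}\big\|\eta_n(\omega,\cdot,\vartheta)\big\|_{L^q}+\varepsilon_n(\omega)\qquad\text{for every }\omega\in\Omega.$$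
   Context: Parametric model: $\Theta\subset\mathbb{R}^d$, and $\{p_\vartheta:\vartheta\in\Theta\}$ is a family of probability density functions, each with support $(0,\infty)$, positive and continuously differentiable on $(0,\infty)$; $P_\vartheta$ is the distribution function of $p_\vartheta$. For every $\vartheta\in\Theta$ it is assumed that $$\int_0^\infty |x|\,|p_\vartheta'(x)|\,dx<\infty,\qquad \sup_{x>0}\frac{p_\vartheta'(x)\min\{P_\vartheta(x),1-P_\vartheta(x)\}}{p_\vartheta(x)^2}<\infty,\qquad \lim_{x\searrow0}\frac{P_\vartheta(x)}{p_\vartheta(x)}=0.$$ Sample: $(\Omega,\mathcal{F},\mathbb{P})$ is a complete probability space, $\vartheta_0\in\Theta$, and $X_1,\dots,X_n:\Omega\to(0,\infty)$ are i.i.d. random variables with density $p_{\vartheta_0}$. It is assumed that $\mathbb{E}\left|\frac{p_\vartheta'(X_1)}{p_\vartheta(X_1)}X_1\right|<\infty$ for every $\vartheta\in\Theta$. Norm: $w:(0,\infty)\to(0,\infty)$ is a positive integrable weight function, and $\|f\|_{L^q}=\left(\int_0^\infty|f(t)|^q\,w(t)\,dt\right)^{1/q}$. For $\omega\in\Omega$, $t>0$, $\vartheta\in\Theta$, $$\eta_n(\omega,t,\vartheta)=-\frac1n\sum_{j=1}^n\frac{p_\vartheta'(X_j(\omega))}{p_\vartheta(X_j(\omega))}\min\{X_j(\omega),t\}-\frac1n\sum_{j=1}^n\mathbf{1}\{X_j(\omega)\le t\}.$$ $\mathcal{B}(\Theta)$ is the Borel $\sigma$-field of $\Theta$ with the subspace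 topology from $\mathbb{R}^d$. *)

(* Defs.v *)
From HB Require Import structures.
From mathcomp Require Import all_boot all_order all_algebra.
From mathcomp Require Import all_classical all_reals all_analysis.

Set Implicit Arguments.
Unset Strict Implicit.
Unset Printing Implicit Defensive.

Import Order.TTheory GRing.Theory Num.Theory.
Import numFieldNormedType.Exports.

Local Open Scope classical_set_scope.
Local Open Scope ring_scope.

(* The Borel sets of T.  For [A : set T], [borel A] (with A coerced to
   [set_type A]) is taken with respect to the subspace topology. *)
Definition borel (T : topologicalType) : set (set T) := <<s @open T >>.
Arguments borel T : clear implicits.

(* Densities are functions on the whole line vanishing on ]-oo, 0]; measurability
   follows from the conditions on ]-oo, 0] and ]0, +oo[. *)
Record C1_density_on_pos (R : realType) (f : R -> R) : Prop := {
  density_out : forall x : R, x <= 0 -> f x = 0;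
  density_pos : forall x : R, 0 < x -> 0 < f x;
  density_derivable : forall x : R, 0 < x -> derivable f x 1;
  density_continuous_derive : forall x : R, 0 < x -> {for x, continuous (derive1 f)};
  density_mass : (\int[lebesgue_measure]_x (f x)%:E = 1)%E }.

Definition distr_fun (R : realType) (f : R -> R) (x : R) : R :=
  \int[lebesgue_measure]_(t in `]-oo, x]) f t.

Record regular_density (R : realType) (f : R -> R) : Prop := {
  regular_integral :
    (\int[lebesgue_measure]_(x in `]0%R, +oo[)
       (`|x| * `|derive1 f x|)%R%:E < +oo)%E;
  regular_sup :
    (ereal_sup [set (derive1 f x * Num.min (distr_fun f x) (1 - distr_fun f x)
                     / f x ^+ 2)%R%:E | x in [set x : R | (0 < x)%R]]
     < +oo)%E;
  regular_lim : distr_fun f x / f x @[x --> 0^'+] --> (0 : R) }.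

Definition has_density d (Omega : measurableType d) (R : realType)
    (Pr : probability Omega R) (X : {RV Pr >-> R}) (f : R -> R) : Prop :=
  forall A : set R, measurable A ->
    (distribution Pr X A = \int[lebesgue_measure]_(x in A) (f x)%:E)%E.

Definition mutually_independent d (Omega : measurableType d) (R : realType)
    (Pr : probability Omega R) (I : finType) (X : I -> {RV Pr >-> R}) : Prop :=
  forall (J : {set I}) (A : I -> set R), (forall i, measurable (A i)) ->
    (Pr (\bigcap_(i in [set` J]) (X i @^-1` A i)) =
     \prod_(i in J) Pr (X i @^-1` A i))%E.

Definition weighted_Lnorm (R : realType) (w : R -> R) (q : R) (f : R -> R) :
    \bar R :=
  ((\int[lebesgue_measure]_(t in `]0%R, +oo[) (`|f t| `^ q * w t)%R%:E)
     `^ q^-1)%E.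

(* [p] is a family of densities indexed by [Theta] and [x j] is the observed
   value of the j-th sample variable. *)
Definition eta_n (R : realType) (Theta : Type) (p : Theta -> R -> R) (n : nat)
    (x : 'I_n -> R) (t : R) (theta : Theta) : R :=
  - (n%:R^-1 * \sum_(j < n)
       derive1 (p theta) (x j) / p theta (x j) * Num.min (x j) t)
  - n%:R^-1 * \sum_(j < n) (x j <= t)%R%:R.

(* Main.v *)
(** Let [N omega theta] be the norm of [eta_n(omega, ., theta)].  Continuity of
    the scores makes [N omega] sequentially continuous for each [omega]
    (dominated convergence, [eta_n] being bounded in [t]), so only its values at
    a sequence [a] dense in [Theta] matter.  The estimator is [a k] for the least
    [k] with [N omega (a k) <= N omega (a m) + eps omega] for all [m]: comparing
    with the countably many [N omega (a m)] rather than with the infimum over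
    [Theta] keeps this event measurable, and [omega |-> N omega (a k)] is
    measurable by Tonelli. *)
Require Import Defs.
From HB Require Import structures.
From mathcomp Require Import all_boot all_order all_algebra.
From mathcomp Require Import all_classical all_reals all_analysis.
From mathcomp Require Import measurable_realfun.

Set Implicit Arguments.
Unset Strict Implicit.
Unset Printing Implicit Defensive.

Import Order.TTheory GRing.Theory Num.Theory.
Import numFieldNormedType.Exports.

Local Open Scope classical_set_scope.
Local Open Scope ring_scope.

(** * Measurable selection of an approximate minimiser *)

Lemma measurable_approx_argmin d (Omega : measurableType d) (R : realType)
    (T : Type) (a : nat -> T) (N : Omega -> T -> \bar R) (eps : Omega -> R) :
  (forall omega theta, 0 <= N omega theta)%E ->
  (forall omega theta, N omega theta < +oo)%E ->
  (forall k, measurable_fun setT (N ^~ (a k))) ->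
  measurable_fun setT eps ->
  (forall omega, 0 < eps omega) ->
  (forall omega theta, exists u : nat -> nat,
    N omega (a (u k)) @[k --> \oo] --> N omega theta) ->
  exists theta_hat : Omega -> T,
    (forall B : set T, measurable (theta_hat @^-1` B)) /\
    forall omega theta, (N omega (theta_hat omega) <=
      N omega theta + (eps omega)%:E)%E.
Proof.
move=> N0 Noo mN meps eps0 Nlim.
pose S k := [set omega |
  forall m, (N omega (a k) <= N omega (a m) + (eps omega)%:E)%E].
have mS k : measurable (S k).
  have -> : S k = \bigcap_m (setT `&`
      [set omega | (N omega (a k) <= N omega (a m) + (eps omega)%:E)%E]).
    apply/seteqP; split => [omega Sk m _|omega Sk m].
      by split => //; exact: Sk.
    by have [] := Sk m I.
  apply: bigcapT_measurable => m; apply: measurable_lee => //.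
  by apply: emeasurable_funD => //; exact/measurable_EFinP.
(* The values along [a] have a finite infimum, so some [N omega (a k)] lies within [eps omega > 0]
   of it; such a [k] satisfies [S k omega]. *)
have exS omega : exists k, `[< S k omega >].
  have inf_fin : ereal_inf (range (fun m => N omega (a m))) \is a fin_num.
    rewrite ge0_fin_numE; last by apply: le_ereal_inf_tmp => _ [m _ <-].
    apply: le_lt_trans (Noo omega (a 0%N)).
    by apply: ereal_inf_lbound; exists 0%N.
  have [_ [k _ <-] /ltW Nk] := lb_ereal_inf_adherent (eps0 omega) inf_fin.
  exists k; apply/asboolP => m; apply: le_trans Nk _.
  by rewrite leeD2r//; apply: ereal_inf_lbound; exists m.
pose kappa omega := ex_minn (exS omega).
have kappaS omega : S (kappa omega) omega.
  by rewrite /kappa; case: ex_minnP => k /asboolP.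
have mkappa i : measurable [set omega | kappa omega = i].
  have -> : [set omega | kappa omega = i] =
      S i `&` \bigcap_(j in `I_i) ~` S j.
    apply/seteqP; split => [omega <-|omega [Si nS]]/=.
      split; first exact: kappaS.
      move=> j /=; rewrite /kappa; case: ex_minnP => k _ kmin jk Sj.
      by have := kmin j (asboolT Sj); rewrite leqNgt jk.
    rewrite /kappa; case: ex_minnP => k /asboolP Sk kmin.
    apply/eqP; rewrite eqn_leq kmin ?asboolT//= leqNgt.
    by apply/negP => /nS; exact.
  apply: measurableI => //; apply: bigcap_measurableType => j _.
  exact: measurableC.
(* The selector takes countably many values, so the preimage of an arbitrary [B] is a countable
   union of level sets of [kappa]. *)
exists (a \o kappa); split => [B|omega theta].
  have -> : (a \o kappa) @^-1` B =
      \bigcup_(i in a @^-1` B) [set omega | kappa omega = i].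
    apply/seteqP; split => [omega Bk|omega [i Bi ki]]/=; last by rewrite ki.
    by exists (kappa omega).
  exact: bigcup_measurable.
(* From the sequence to all of [T]: the selected value minus [eps omega] is below every
   [N omega (a (u k))], hence below their limit [N omega theta]. *)
have [u u_cvg] := Nlim omega theta.
rewrite -leeBlDr//.
rewrite -(cvg_lim _ u_cvg)//; apply: lime_ge; first exact: cvgP u_cvg.
by apply: nearW => k; rewrite leeBlDr//; exact: kappaS.
Qed.

(** * A sequence dense in a subspace of a Euclidean space *)

Lemma subspace_sequential_density (R : realType) (dim : nat)
    (A : set 'rV[R]_dim) : A !=set0 ->
  exists a : nat -> A, forall x : A, exists u : nat -> nat,
    a (u k) @[k --> \oo] --> x.
Proof.
case=> x0 Ax0.
pose x0' : A := exist _ x0 (mem_set Ax0).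
pose near_rat (r : 'rV[rat]_dim) (m : nat) (y : A) :=
  ball (map_mx ratr r : 'rV[R]_dim) m.+1%:R^-1 (set_val y).
(* Rational points may miss [A], so each code of a pair [(r, m)] selects a point of [A] within
   [1/(m+1)] of [r] when there is one. All other codes give the default [x0']. *)
pose a k : A := match unpickle k : option ('rV[rat]_dim * nat)%type with
  | Some (r, m) => if pselect (exists y, near_rat r m y) is left h
                   then projT1 (cid h) else x0'
  | None => x0' end.
exists a => x.
have apx m : exists k,
    ball (set_val x) (m.+1%:R^-1 + m.+1%:R^-1) (set_val (a k)).
  (* Balls of row vectors are coordinatewise, so a rational centre near [x] is found entry by entry.
     Then [x] itself witnesses that the search around [r] succeeds, and the selected point is within
     twice the radius of [x]. *)
  have /choice[r rP] : forall i, exists s : rat,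
      ball ((set_val x : 'rV[R]_dim) ord0 i) m.+1%:R^-1 (ratr s : R).
    move=> i; set z := (X in ball X).
    have /rat_in_itvoo[s] : z - m.+1%:R^-1 < z + m.+1%:R^-1.
      by rewrite ltrD2l gtrN.
    by move=> zs; exists s; rewrite ball_itv.
  have xr : near_rat (\row_i r i) m x.
    apply: ball_sym; split=> // i j; rewrite !mxE [i]ord1; exact: rP.
  exists (pickle ((\row_i r i), m)); rewrite /a pickleK.
  case: pselect => [h|[]]; last by exists x.
  case: cid => y /= yr; exact: ball_triangle (ball_sym xr) yr.
have [u uP] := choice apx.
exists u; apply/cvg_ballP => e e0.
have e20 : 0 < e / 2 by rewrite divr_gt0.
have := near_infty_natSinv_lt (PosNum e20); apply: filterS => k /= ke.
(* Balls of the subspace are preimages of ambient balls under [set_val]. *)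
rewrite -initial_ballE /=.
apply: le_ball (uP k).
by rewrite (splitr e) lerD// ltW.
Qed.

(** * Powers of absolute values and the weighted norm *)

Lemma continuous_powR_norm (R : realType) (q : R) : 0 < q ->
  continuous (fun x : R => `|x| `^ q).
Proof.
(* The power is differentiable only at a positive base, so 0 is treated apart: there [|y| < e^(1/q)]
   gives [|y|^q < e]. *)
move=> q0 x; have [->|x0] := eqVneq x 0.
  apply/cvgrPdist_lt => e e0; near=> y.
  rewrite normr0 powR0 ?gt_eqF// sub0r normrN ger0_norm ?powR_ge0//.
  rewrite -[ltRHS](@powRr1 _ e) ?ltW// -[X in _ < _ `^ X](mulVf (lt0r_neq0 q0)).
  rewrite powRrM gt0_ltr_powR ?nnegrE ?powR_ge0//.
  near: y; exact: (@nbhs0_lt _ R _ (powR_gt0 _ e0)).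
apply: (@continuous_comp _ _ _ (fun x : R => `|x|) (@powR R ^~ q)).
  exact: (@norm_continuous _ R).
have := @is_derive1_powR R q `|x| (etrans (normr_gt0 x) x0).
move=> /@ex_derive /derivable1_diffP/differentiable_continuous; exact.
Unshelve. all: by end_near.
Qed.

Lemma cvg_powR_norm (R : realType) (q : R) (u : nat -> R) (l : R) : 0 < q ->
  u k @[k --> \oo] --> l -> `|u k| `^ q @[k --> \oo] --> `|l| `^ q.
Proof.
move=> q0; apply: (@continuous_cvg _ R R _ _ u (fun x : R => `|x| `^ q) l).
exact: continuous_powR_norm.
Qed.

Section weighted_Lnorm.
Context (R : realType) (w : R -> R) (q : R)
  (w_pos : forall t, 0 < t -> 0 < w t)
  (w_integrable : lebesgue_measure.-integrable `]0, +oo[ (EFin \o w))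
  (q0 : 0 < q).

Let measurable_w : measurable_fun (`]0, +oo[ : set R) w.
Proof. by apply/measurable_EFinP; case/integrableP: w_integrable. Qed.

Lemma measurable_weighted (f : R -> R) : measurable_fun setT f ->
  measurable_fun (`]0, +oo[ : set R) (fun t => (`|f t| `^ q * w t)%:E).
Proof.
move=> mf; apply/measurable_EFinP; apply: measurable_funM => //.
apply: measurable_funTS; apply: (measurableT_comp (measurable_powR q)).
exact: measurableT_comp.
Qed.

Lemma integral_weighted_lty (f : R -> R) (M : R) :
  measurable_fun setT f -> (forall t, 0 < t -> `|f t| <= M) ->
  (\int[lebesgue_measure]_(t in `]0%R, +oo[) (`|f t| `^ q * w t)%R%:E < +oo)%E.
Proof.
move=> mf fM.
have Mw : lebesgue_measure.-integrable `]0, +oo[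
    (fun t => (M `^ q)%:E * (w t)%:E)%E.
  exact: integrableZl.
case/integrableP: (Mw) => mMw; apply: le_lt_trans.
apply: ge0_le_integral => //.
- move=> t /=; rewrite in_itv/= andbT => t0.
  by rewrite lee_fin mulr_ge0 ?powR_ge0// ltW// w_pos.
- exact: measurable_weighted.
- exact: measurableT_comp.
- move=> t /=; rewrite in_itv/= andbT => t0.
  have w0 := ltW (w_pos t0).
  rewrite lee_fin [leRHS]ger0_norm ?mulr_ge0 ?powR_ge0// ler_wpM2r//.
  have M0 := le_trans (normr_ge0 _) (fM _ t0).
  by rewrite (ge0_ler_powR (ltW q0)) ?nnegrE// fM.
Qed.

Lemma weighted_Lnorm_lty (f : R -> R) (M : R) :
  measurable_fun setT f -> (forall t, 0 < t -> `|f t| <= M) ->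
  (weighted_Lnorm w q f < +oo)%E.
Proof. by move=> mf fM; apply: poweR_lty; exact: integral_weighted_lty fM. Qed.

(** Dominated convergence with the integrable majorant [M^q w], followed by continuity of the power
    [1/q]. *)
Lemma cvg_weighted_Lnorm (f_ : nat -> R -> R) (f : R -> R) (M : R) :
  (forall k, measurable_fun setT (f_ k)) -> measurable_fun setT f ->
  (forall k t, 0 < t -> `|f_ k t| <= M) ->
  (forall t, 0 < t -> f_ k t @[k --> \oo] --> f t) ->
  weighted_Lnorm w q (f_ k) @[k --> \oo] --> weighted_Lnorm w q f.
Proof.
move=> mf_ mf f_M f_f.
have fM t : 0 < t -> `|f t| <= M.
  move=> t0; have f_ft : `|f_ k t| @[k --> \oo] --> `|f t|.
    by apply: cvg_norm; exact: f_f.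
  rewrite -(cvg_lim _ f_ft)//; apply: limr_le; first exact: cvgP f_ft.
  by apply: nearW => k; exact: f_M.
pose I_ (g : R -> R) : \bar R :=
  (\int[lebesgue_measure]_(t in `]0%R, +oo[) (`|g t| `^ q * w t)%R%:E)%E.
have I_ge0 (g : R -> R) : (0 <= I_ g)%E.
  apply: integral_ge0 => t /=; rewrite in_itv/= andbT => t0.
  by rewrite lee_fin mulr_ge0 ?powR_ge0// ltW// w_pos.
have I_fin (g : R -> R) :
    measurable_fun setT g -> (forall t, 0 < t -> `|g t| <= M) ->
    I_ g \is a fin_num.
  by move=> mg gM; rewrite ge0_fin_numE//; exact: integral_weighted_lty gM.
have I_cvg : I_ (f_ k) @[k --> \oo] --> I_ f.
  apply: (@dominated_cvg _ _ R lebesgue_measure `]0, +oo[ _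
    (fun k t => (`|f_ k t| `^ q * w t)%:E) (fun t => (`|f t| `^ q * w t)%:E)
    (fun t => (M `^ q)%:E * (w t)%:E)%E) => //.
  - by move=> k; exact: measurable_weighted.
  - move=> t /=; rewrite in_itv/= andbT => t0.
    apply: cvg_EFin; first exact: nearW.
    by apply: cvgMr_tmp; apply: cvg_powR_norm => //; exact: f_f.
  - exact: integrableZl.
  - move=> k t /=; rewrite in_itv/= andbT => t0.
    have w0 := ltW (w_pos t0).
    rewrite lee_fin [leLHS]ger0_norm ?mulr_ge0 ?powR_ge0// ler_wpM2r//.
    have M0 := le_trans (normr_ge0 _) (f_M k _ t0).
    by rewrite (ge0_ler_powR (ltW q0)) ?nnegrE// f_M.
(* The absolute value changes nothing on a nonnegative integral; it gives the outer root the shape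
   of [cvg_powR_norm] with exponent [q^-1]. *)
have I_poweR (g : R -> R) :
    measurable_fun setT g -> (forall t, 0 < t -> `|g t| <= M) ->
    weighted_Lnorm w q g = (`|fine (I_ g)| `^ q^-1)%:E.
  move=> mg gM.
  rewrite /weighted_Lnorm -/(I_ g) -[in LHS](fineK (I_fin g mg gM)).
  by rewrite poweR_EFin ger0_norm// fine_ge0.
rewrite I_poweR//; under eq_fun do rewrite (I_poweR _ (mf_ _) (f_M _)).
apply: cvg_EFin; first exact: nearW.
apply: cvg_powR_norm; first by rewrite invr_gt0.
by apply: fine_cvg; rewrite fineK// I_fin.
Qed.

Lemma measurable_weighted_Lnorm d (Omega : measurableType d)
    (f : Omega * R -> R) : measurable_fun setT f ->
  measurable_fun setT (fun omega => weighted_Lnorm w q (fun t => f (omega, t))).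
Proof.
move=> mf; apply: (measurableT_comp (f := @poweR R ^~ q^-1) (g := fun omega =>
    (\int[lebesgue_measure]_(t in `]0%R, +oo[)
      (`|f (omega, t)| `^ q * w t)%R%:E)%E)).
  exact: measurable_poweR.
(* Tonelli is applied on the whole product, while [w] is controlled only on the half-line; it is
   therefore extended by zero, which leaves the integral unchanged. *)
pose D : set R := `]0, +oo[%classic.
pose g (z : Omega * R) := (`|f z| `^ q * (w \_ D) z.2)%:E.
have mg : measurable_fun setT g.
  apply/measurable_EFinP; apply: measurable_funM.
    by apply: (measurableT_comp (measurable_powR q)); exact: measurableT_comp.
  apply: measurableT_comp measurable_snd.
  exact: (measurable_restrictT w (measurable_itv _)).1 measurable_w.
have g0 z : (0 <= g z)%E.
  rewrite lee_fin mulr_ge0 ?powR_ge0// patchE; case: ifPn => //.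
  by rewrite inE/= /D/= in_itv/= andbT => t0; rewrite ltW// w_pos.
have := @measurable_fun_fubini_tonelli_F _ _ Omega _ R lebesgue_measure g mg g0.
apply: eq_measurable_fun => omega _; rewrite /fubini_F [RHS]integral_mkcond.
apply: eq_integral => t _; rewrite /g !patchE.
by case: ifPn => //; rewrite mulr0.
Qed.

End weighted_Lnorm.

(** * Measurability, convergence and bounds for the score and [eta_n] *)

Lemma measurable_score (R : realType) (f : R -> R) : C1_density_on_pos f ->
  measurable_fun (`]0, +oo[ : set R) (fun x => derive1 f x / f x).
Proof.
move=> fC1; apply: open_continuous_measurable_fun; first exact: interval_open.
move=> x; rewrite inE/= in_itv/= andbT => x0.
apply: cvgM; first exact: (density_continuous_derive fC1 x0).
apply: cvgV; first by rewrite gt_eqF// (density_pos fC1).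
have /derivable1_diffP := density_derivable fC1 x0.
exact: differentiable_continuous.
Qed.

Section eta_n.
Context (R : realType) (Theta : Type) (p : Theta -> R -> R) (n : nat).

Let score theta x := derive1 (p theta) x / p theta x.

(** The space [T] is left general to cover two uses: sections in [t] with the sample fixed, and
    joint measurability in [(omega, t)] for Tonelli. *)
Lemma measurable_eta_n d (T : measurableType d) (x : 'I_n -> T -> R)
    (t : T -> R) (theta : Theta) :
  (forall j, measurable_fun setT (x j)) ->
  (forall j, measurable_fun setT (fun z => score theta (x j z))) ->
  measurable_fun setT t ->
  measurable_fun setT (fun z => eta_n p (x ^~ z) (t z) theta).
Proof.
move=> mx ms mt; apply: measurable_funB.
  apply: measurableT_comp => //; apply: measurable_funM => //.
  apply: measurable_sum => j; apply: measurable_funM; first exact: ms.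
  exact: measurable_minr.
apply: measurable_funM => //; apply: measurable_sum => j.
have : measurable_fun setT (fun z => if x j z <= t z then 1 else 0 : R).
  by apply: measurable_fun_ifT => //; exact: measurable_fun_ler.
by apply: eq_measurable_fun => z _; case: ifP.
Qed.

Lemma cvg_eta_n (theta_ : nat -> Theta) (theta : Theta)
    (x : 'I_n -> R) (t : R) :
  (forall j, score (theta_ k) (x j) @[k --> \oo] --> score theta (x j)) ->
  eta_n p x t (theta_ k) @[k --> \oo] --> eta_n p x t theta.
Proof.
move=> sc; apply: cvgB; last exact: cvg_cst.
apply: cvgN; apply: cvgMl_tmp.
apply: cvg_big => [|j _]; first exact: add_continuous.
by apply: cvgMr_tmp; exact: sc.
Qed.

(** Since [0 < min(x j, t) <= x j] and indicators are at most 1, the bound is free of [t]. *)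
Lemma eta_n_bounded (theta : Theta) (x : 'I_n -> R) (t : R) :
  (forall j, 0 < x j) -> 0 < t ->
  `|eta_n p x t theta| <=
    n%:R^-1 * (\sum_(j < n) `|score theta (x j)| * x j) + n%:R^-1 * n%:R.
Proof.
move=> x0 t0; apply: le_trans (ler_normB _ _) _.
rewrite normrN !normrM ger0_norm// lerD// ler_wpM2l//.
  apply: le_trans (ler_norm_sum _ _ _) _; apply: ler_sum => j _.
  rewrite normrM ler_wpM2l// ger0_norm ?ge_min ?lexx//.
  by rewrite le_min !ltW.
apply: le_trans (ler_norm_sum _ _ _) _.
rewrite -[X in _ <= X%:R](card_ord n) -sum1_card natr_sum.
by apply: ler_sum => j _; case: (x j <= t); rewrite ?normr1 ?normr0.
Qed.

(** The bounds of [eta_n_bounded] converge along [theta_], hence form a bounded sequence; this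
    supplies the constant for dominated convergence. *)
Lemma eta_n_seq_bounded (theta_ : nat -> Theta) (theta : Theta)
    (x : 'I_n -> R) :
  (forall j, 0 < x j) ->
  (forall j, score (theta_ k) (x j) @[k --> \oo] --> score theta (x j)) ->
  exists M, forall k t, 0 < t -> `|eta_n p x t (theta_ k)| <= M.
Proof.
move=> x0 sc.
pose b k := n%:R^-1 * (\sum_(j < n) `|score (theta_ k) (x j)| * x j) +
  n%:R^-1 * n%:R.
have b_cvg : cvgn b.
  apply: is_cvgD; last exact: is_cvg_cst.
  apply: is_cvgMl_tmp; apply: (cvgP (\sum_(j < n) `|score theta (x j)| * x j)).
  apply: cvg_big => [|j _]; first exact: add_continuous.
  by apply: cvgMr_tmp; apply: cvg_norm; exact: sc.
have /pinfty_ex_gt0[M _ bM] := cvg_seq_bounded b_cvg.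
exists M => k t t0; apply: le_trans (eta_n_bounded _ x0 t0) _.
exact: le_trans (ler_norm _) (bM k I).
Qed.

End eta_n.

(** * Construction of the estimator *)

Theorem mainTheorem2 (R : realType)
    (dim : nat) (hdim : (0 < dim)%N)
    (Theta : set 'rV[R]_dim)
    (Theta_nonempty : Theta !=set0)
    (Theta_borel : borel 'rV[R]_dim Theta)
    (p : Theta -> R -> R)
    (p_density : forall theta, C1_density_on_pos (p theta))
    (p_regular : forall theta, regular_density (p theta))
    (disp : measure_display) (Omega : measurableType disp)
    (Pr : probability Omega R)
    (Pr_complete : measure_is_complete Pr)
    (n : nat) (hn : (0 < n)%N)
    (theta0 : Theta)
    (X : 'I_n -> {RV Pr >-> R})
    (X_pos : forall j omega, 0 < X j omega)
    (X_density : forall j, has_density (X j) (p theta0))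
    (X_indep : mutually_independent X)
    (X_moment : forall theta,
      let X1 := X (Ordinal hn) in
      ('E_Pr[fun omega => `|derive1 (p theta) (X1 omega) / p theta (X1 omega)
                            * X1 omega|%R] < +oo)%E)
    (w : R -> R)
    (w_pos : forall t, 0 < t -> 0 < w t)
    (w_integrable : lebesgue_measure.-integrable `]0, +oo[ (EFin \o w))
    (q : R) (hq : 1 <= q)
    (score_continuous : forall x : R, 0 < x ->
      continuous (fun theta : Theta => derive1 (p theta) x / p theta x))
    (eps : {RV Pr >-> R})
    (eps_pos : forall omega, 0 < eps omega) :
  exists theta_hat : Omega -> Theta,
    (forall B : set Theta, borel Theta B -> measurable (theta_hat @^-1` B)) /\
    forall omega : Omega,
      let eta_norm theta :=
        weighted_Lnorm w q (fun t => eta_n p (X ^~ omega) t theta) in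
      (eta_norm (theta_hat omega) <=
        ereal_inf [set eta_norm theta | theta in [set: Theta]]
        + (eps omega)%:E)%E.
Proof.
have q0 : 0 < q := lt_le_trans ltr01 hq.
pose eta_norm omega theta :=
  weighted_Lnorm w q (fun t => eta_n p (X ^~ omega) t theta).
have mscore theta j : measurable_fun setT
    (fun omega => derive1 (p theta) (X j omega) / p theta (X j omega)).
  have := measurable_score (p_density theta).
  (* The score is measurable on the half-line only; its extension by zero agrees with it at
     [X j omega > 0]. *)
  move=> /(measurable_restrictT _ (measurable_itv _)).1 ms.
  apply: eq_measurable_fun (measurableT_comp ms (measurable_funPT (X j))).
  move=> omega _ /=; rewrite patchE ifT// inE/= in_itv/= andbT; exact: X_pos.
have meta_section omega theta :
    measurable_fun setT (fun t => eta_n p (X ^~ omega) t theta).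
  exact: (@measurable_eta_n _ _ p n _ _ (fun j _ => X j omega)).
have [a a_dense] := subspace_sequential_density Theta_nonempty.
have score_cvg omega theta (u : nat -> nat) : a (u k) @[k --> \oo] --> theta ->
    forall j, derive1 (p (a (u k))) (X j omega) / p (a (u k)) (X j omega)
      @[k --> \oo] --> derive1 (p theta) (X j omega) / p theta (X j omega).
  move=> au j; apply: (@continuous_cvg _ Theta R _ _ (a \o u)
    (fun theta => derive1 (p theta) (X j omega) / p theta (X j omega))) => //.
  exact: (score_continuous _ (X_pos j omega)).
have [||||||theta_hat [mtheta_hat theta_hatP]] :=
  @measurable_approx_argmin _ Omega R Theta a eta_norm eps.
- by move=> omega theta; exact: poweR_ge0.
- move=> omega theta.
  exact: (weighted_Lnorm_lty w_pos w_integrable q0 (meta_section omega theta)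
    (fun t => @eta_n_bounded _ _ p n theta _ t (X_pos^~ omega))).
- move=> k; apply: (measurable_weighted_Lnorm q w_pos w_integrable
    (f := fun z => eta_n p (X ^~ z.1) z.2 (a k))).
  apply: (@measurable_eta_n _ _ p n _ _ (fun j z => X j z.1) snd) => // j.
    exact: measurableT_comp (measurable_funPT (X j)) measurable_fst.
  exact: (measurableT_comp (mscore (a k) j) measurable_fst).
- exact: measurable_funPT.
- exact: eps_pos.
- move=> omega theta; have [u au] := a_dense theta; exists u.
  have sc := score_cvg omega theta u au.
  have [M etaM] := eta_n_seq_bounded (X_pos ^~ omega) sc.
  apply: (cvg_weighted_Lnorm w_pos w_integrable q0 _ _ etaM).
  + by move=> k; exact: meta_section.
  + exact: meta_section.
  + by move=> t _; exact: cvg_eta_n sc.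
exists theta_hat; split => [B _|omega]; first exact: mtheta_hat.
(* Moving the finite [eps omega] to the left reduces the claim to a lower bound for each
   [eta_norm omega theta]. *)
cbv zeta; rewrite -leeBlDr//; apply: le_ereal_inf_tmp => _ [theta _ <-].
by rewrite leeBlDr//; exact: theta_hatP.
Qed.
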